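(* Let $F=F(x_1,x_2)$ be the (multivalued) algebraic function defined by $$16F^6+32x_2(27x_1^2-x_2^3)F^4+16x_2^2(27x_1^2-x_2^3)^2F^2+x_1^2(27x_1^2+8x_2^3)^3=0.$$ Then the Stokes set $\mathcal{S}$ of the Pearcey system is $$\mathcal{S}=\{(x_1,x_2)\in\mathbb{C}^2\mid \operatorname{Im}F=0\},$$ i.e. $(x_1,x_2)\in\mathcal{S}$ if and only if some root $F\in\mathbb{C}$ (branch) of the equation $16F^6+32x_2(27x_1^2-x_2^3)F^4+16x_2^2(27x_1^2-x_2^3)^2F^2+x_1^2(27x_1^2+8x_2^3)^3=0$ at $(x_1,x_2)$ satisfies $\operatorname{Im}F=0$. Hence $\mathcal{S}$ is a semialgebraic set as a subset of $\mathbb{C}^2\simeq\mathbb{R}^4$. In particular, the self-intersection sets of Stokes surfaces are also semialgebraic.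
   Context: Let $\zeta_1,\zeta_2,\zeta_3$ be the roots of $4\zeta^3+2x_2\zeta+x_1=0$ and put $\omega_{-1}^{(\ell)}=\zeta_\ell\,dx_1+\zeta_\ell^2\,dx_2$ ($\ell=1,2,3$); these are closed 1-forms, with primitives $\frac14(3x_1\zeta_\ell+2x_2\zeta_\ell^2)$. For $\ell\neq k$, a point $\tau\in\mathbb{C}^2$ is a turning point of type $(\ell,k)$ if $\omega_{-1}^{(\ell)}(\tau)=\omega_{-1}^{(k)}(\tau)$; the set of all turning points is $T=\{27x_1^2+8x_2^3=0\}$. For a turning point $\tau\ne(0,0)$ of type $(\ell,k)$, the Stokes surface (of type $(\ell,k)$) passing through $\tau$ is $$\mathcal{S}_\tau=\left\{x\in\mathbb{C}^2\ \middle|\ \operatorname{Im}\int_\tau^x\left(\omega_{-1}^{(\ell)}-\omega_{-1}^{(k)}\right)=0\right\}.$$ The Stokes set $\mathcal{S}$ is the union of all $\mathcal{S}_\tau$ over turning points of any type; equivalently it is the union over $\ell<k$ of the sets $\{x\in\mathbb{C}^2\mid \operatorname{Im}\int_0^x(\omega_{-1}^{(\ell)}-\omega_{-1}^{(k)})=0\}$. The self-intersection sets are the sets of points where Stokes surfaces of different types meet. *)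

(* Defs.v *)
From mathcomp Require Import all_boot all_algebra mpoly.
From mathcomp Require Import Rstruct.
From Stdlib Require Import Reals.
From Coquelicot Require Import Coquelicot.

Set Implicit Arguments.
Unset Strict Implicit.
Unset Printing Implicit Defensive.

Local Open Scope R_scope.
Local Open Scope C_scope.

Notation C2 := (C * C)%type.

Inductive label : Set := l1 | l2 | l3.

(* r lists, with multiplicity, the roots of 4 w^3 + 2 x2 w + x1. *)
Definition root_triple (x : C2) (r : label -> C) : Prop :=
  forall w : C,
    4 * w ^ 3 + 2 * x.2 * w + x.1 = 4 * (w - r l1) * (w - r l2) * (w - r l3).

(* A covector a dx1 + b dx2 is the pair (a, b). *)
Definition omega (z : C) : C2 := (z, z ^ 2).

Definition covector_sub (a b : C2) : C2 := (a.1 - b.1, a.2 - b.2).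

Definition pairing (a v : C2) : C := a.1 * v.1 + a.2 * v.2.

Definition turning_type (r : label -> C) (l k : label) : Prop :=
  l <> k /\ omega (r l) = omega (r k).

(* The type depends on how the roots at tau are numbered. *)
Definition turning_point (tau : C2) : Prop :=
  exists (r : label -> C) (l k : label),
    root_triple tau r /\ turning_type r l k.

Definition unit_interval (t : R) : Prop := (0 <= t <= 1)%R.

(* g is a C^1 path from a to b; dg is its velocity, extended continuously to
   the endpoints. *)
Definition C1_path (a b : C2) (g dg : R -> C2) : Prop :=
  [/\ g 0%R = a,
      g 1%R = b,
      continuous_on unit_interval g,
      continuous_on unit_interval dg &
      forall t : R, (0 < t < 1)%R ->
        is_derive (K := R_AbsRing) (V := C_R_NormedModule)
          (fun s => (g s).1) t (dg t).1 /\
        is_derive (K := R_AbsRing) (V := C_R_NormedModule)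
          (fun s => (g s).2) t (dg t).2].

(* z continues the three roots continuously along g; z l and z k are different
   branches whenever l <> k, even where their values coincide. *)
Definition root_branches (g : R -> C2) (z : R -> label -> C) : Prop :=
  (forall t : R, unit_interval t -> root_triple (g t) (z t)) /\
  (forall l : label, continuous_on unit_interval (fun t => z t l)).

Definition int_omega_diff (dg : R -> C2) (z : R -> label -> C) (l k : label) : C :=
  RInt (V := C_R_CompleteNormedModule)
    (fun t => pairing (covector_sub (omega (z t l)) (omega (z t k))) (dg t)) 0 1.

(* The Stokes surface through tau of type (l, k).  The forms omega (z l) are
   multivalued, so they are continued along a path from tau to x.  The labels
   of the continued branches are those that zeta gives to the roots at the end
   point x; in this labelling the branches l and k are the ones that coalesce at
   tau. *)
Definition stokes_surface_type (zeta : C2 -> label -> C) (tau : C2) (l k : label)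
    (x : C2) : Prop :=
  exists (g dg : R -> C2) (z : R -> label -> C),
    [/\ C1_path tau x g dg,
        root_branches g z,
        (forall j : label, z 1%R j = zeta x j),
        turning_type (z 0%R) l k &
        Im (int_omega_diff dg z l k) = 0%R].

Definition stokes_surface (zeta : C2 -> label -> C) (tau x : C2) : Prop :=
  exists l k : label, stokes_surface_type zeta tau l k x.

Definition stokes_set (zeta : C2 -> label -> C) (x : C2) : Prop :=
  exists tau : C2,
    [/\ turning_point tau, tau <> (RtoC 0, RtoC 0) & stokes_surface zeta tau x].

(* (l, k) and (k, l) define the same surface. *)
Definition same_type (l k l' k' : label) : Prop :=
  (l = l' /\ k = k') \/ (l = k' /\ k = l').

Definition self_intersection (zeta : C2 -> label -> C) (l k l' k' : label)
    (x : C2) : Prop :=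
  exists tau tau' : C2,
    [/\ turning_point tau /\ tau <> (RtoC 0, RtoC 0),
        turning_point tau' /\ tau' <> (RtoC 0, RtoC 0),
        stokes_surface_type zeta tau l k x &
        stokes_surface_type zeta tau' l' k' x].

Definition stokes_eq (x : C2) (F : C) : Prop :=
  let x1 := x.1 in let x2 := x.2 in
  16 * F ^ 6 + 32 * x2 * (27 * x1 ^ 2 - x2 ^ 3) * F ^ 4
    + 16 * x2 ^ 2 * (27 * x1 ^ 2 - x2 ^ 3) ^ 2 * F ^ 2
    + x1 ^ 2 * (27 * x1 ^ 2 + 8 * x2 ^ 3) ^ 3 = 0.

(* Finite unions of sets {p_1 = ... = p_r = 0, q_1 > 0, ..., q_s > 0}. *)
Definition semialgebraic (n : nat) (A : ('I_n -> R) -> Prop) : Prop :=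
  exists s : seq (seq {mpoly R[n]} * seq {mpoly R[n]}),
    forall v : 'I_n -> R,
      A v <->
      List.Exists (fun b =>
        List.Forall (fun p => meval v p = 0%R) b.1 /\
        List.Forall (fun q => (0 < meval v q)%R) b.2) s.

Definition C2_of_R4 (v : 'I_4 -> R) : C2 :=
  ((v (inord 0), v (inord 1)), (v (inord 2), v (inord 3))).

Definition semialgebraic_C2 (A : C2 -> Prop) : Prop :=
  semialgebraic (fun v : 'I_4 -> R => A (C2_of_R4 v)).

(* Main.v *)
Require Import Defs.
From mathcomp Require Import all_boot all_algebra mpoly.
From mathcomp Require Import Rstruct.
From Stdlib Require Import Reals.
From Coquelicot Require Import Coquelicot.
From Stdlib Require Import Lra.

(** The forms [w dx1 + w ^ 2 dx2], with [w] a root of the cubic, are the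
    differentials of the critical values of the Pearcey phase
    [w ^ 4 + x2 w ^ 2 + x1 w], whose critical points in [w] are the roots.  This
    persists through collisions of roots ([is_deriveC_critical_value]), so the
    integral of a difference of two forms along any path from a turning point,
    where the two critical values agree, is the difference of the critical
    values at the end ([int_omega_diff_phase]).  Conversely, the numbered roots
    of the cubic range over the plane of triples with sum 0, and a segment in that
    plane joins the triple (1, 1, -2) to any other triple.  Hence [x] lies on a
    Stokes surface of type [(l, k)] if and only if the imaginary parts of the
    critical values of the branches [l] and [k] agree at [x]
    ([stokes_surfaceP]).

    By Vieta's formulas, the six roots of the sextic are 4 times the differences
    of critical values ([stokes_eqP]); as 4 is real, the description of the Stokes
    set follows.

    Semialgebraicity is obtained by explicit elimination.  The sextic is
    [16 * (F ^ 2 (F ^ 2 + P) ^ 2 + Q)], so a real root exists if and only if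
    [y (y + P) ^ 2 + Q] has a root [y >= 0], which is decided by [ex_nonneg_root].
    On a self-intersection all three differences of critical values are real, and
    a criterion by discriminant applies ([gaps_realP]). *)

Local Open Scope R_scope.
Local Open Scope C_scope.

(** * Complex-valued functions of a real variable *)

Ltac Cfield := field; move/RtoC_inj; lra.

Lemma Cmult_eq0 (a b : C) : a * b = 0 -> a = 0 \/ b = 0.
Proof.
  move=> ab; have [->|a0] := Ceq_dec a 0; first by left.
  right; transitivity (a * b / a); first by field.
  rewrite ab; field; exact: a0.
Qed.

Lemma continuous_components (T U V : UniformSpace) (f : T -> U * V) (t : T) :
  continuous f t <->
  continuous (fun s => (f s).1) t /\ continuous (fun s => (f s).2) t.
Proof.
  split.
  - move=> H; split.
    + apply: (continuous_comp f fst) => //.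
      rewrite (surjective_pairing (f t)); exact: continuous_fst.
    + apply: (continuous_comp f snd) => //.
      rewrite (surjective_pairing (f t)); exact: continuous_snd.
  - move=> [/filterlim_locally H1 /filterlim_locally H2].
    apply/filterlim_locally => eps.
    by apply: filter_imp (filter_and _ _ (H1 eps) (H2 eps)) => s [].
Qed.

Lemma continuous_C (T : UniformSpace) (f : T -> C) (t : T) :
  continuous f t <->
  continuous (fun s => Re (f s)) t /\ continuous (fun s => Im (f s)) t.
Proof. exact: continuous_components. Qed.

Lemma continuous_Cplus (T : UniformSpace) (f g : T -> C) (t : T) :
  continuous f t -> continuous g t -> continuous (fun s => f s + g s) t.
Proof. exact: (continuous_plus (V := C_R_NormedModule)). Qed.

Lemma continuous_Cmult (T : UniformSpace) (f g : T -> C) (t : T) :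
  continuous f t -> continuous g t -> continuous (fun s => f s * g s) t.
Proof.
  move=> /continuous_C [f1 f2] /continuous_C [g1 g2].
  apply/continuous_C; split => /=.
  - apply: (continuous_minus (V := R_NormedModule));
      apply: (continuous_mult (K := R_AbsRing)) => //.
  - apply: (continuous_plus (V := R_NormedModule));
      apply: (continuous_mult (K := R_AbsRing)) => //.
Qed.

Lemma continuous_Cinv (T : UniformSpace) (f : T -> C) (t : T) :
  continuous f t -> f t <> 0 -> continuous (fun s => / f s) t.
Proof.
  move=> /continuous_C [f1 f2] f0.
  have n0 : (fst (f t) ^ 2 + snd (f t) ^ 2 <> 0)%R.
  { move=> e. apply: f0. rewrite (surjective_pairing (f t)).
    congr pair; nra. }
  have cn : continuous (fun s => / (fst (f s) ^ 2 + snd (f s) ^ 2))%R t.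
  { apply: (continuous_comp (fun s => (fst (f s) ^ 2 + snd (f s) ^ 2)%R) Rinv);
      last exact: continuous_Rinv.
    apply: (continuous_plus (V := R_NormedModule));
      repeat apply: (continuous_mult (K := R_AbsRing)) => //;
      exact: continuous_const. }
  apply/continuous_C; split => /=.
  - exact: (continuous_mult (K := R_AbsRing)).
  - apply: (continuous_mult (K := R_AbsRing)) => //.
    exact: (continuous_opp (V := R_NormedModule)).
Qed.

Notation is_deriveC :=
  (is_derive (K := R_AbsRing) (V := C_R_NormedModule)).

Lemma is_deriveC_components (f : R -> C) (t : R) (l : C) :
  is_deriveC f t l <->
  is_derive (fun s => Re (f s)) t (Re l) /\ is_derive (fun s => Im (f s)) t (Im l).
Proof.
  split.
  - move=> H; split.
    + exact: (filterdiff_comp' f fst t _ fst H (filterdiff_linear _ is_linear_fst)).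
    + exact: (filterdiff_comp' f snd t _ snd H (filterdiff_linear _ is_linear_snd)).
  - move=> [H1 H2].
    apply: (is_derive_ext
      (fun s => plus (scal (Re (f s)) ((1, 0)%R : C_R_NormedModule))
                     (scal (Im (f s)) ((0, 1)%R : C_R_NormedModule)))).
    { move=> s. rewrite [RHS](surjective_pairing (f s)).
      rewrite /scal /plus /= /prod_scal /prod_plus /= /scal /= /mult /plus /=.
      congr pair; rewrite /Re /Im; ring. }
    have -> : l = plus (scal (Re l) ((1, 0)%R : C_R_NormedModule))
                     (scal (Im l) ((0, 1)%R : C_R_NormedModule)).
    { rewrite [LHS](surjective_pairing l).
      rewrite /scal /plus /= /prod_scal /prod_plus /= /scal /= /mult /plus /=.
      congr pair; rewrite /Re /Im; ring. }
    apply: (is_derive_plus (V := C_R_NormedModule)); exact: is_derive_scal_l.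
Qed.

Lemma is_deriveC_plus (f g : R -> C) (t : R) (df dg : C) :
  is_deriveC f t df -> is_deriveC g t dg ->
  is_deriveC (fun s => f s + g s) t (df + dg).
Proof. exact: (is_derive_plus (V := C_R_NormedModule)). Qed.

Lemma is_deriveC_mult (f g : R -> C) (t : R) (df dg : C) :
  is_deriveC f t df -> is_deriveC g t dg ->
  is_deriveC (fun s => f s * g s) t (df * g t + f t * dg).
Proof.
  move=> /is_deriveC_components [f1 f2] /is_deriveC_components [g1 g2].
  apply/is_deriveC_components; split.
  - apply: (is_derive_ext
      (fun s => minus (Re (f s) * Re (g s))%R (Im (f s) * Im (g s))%R)) => //.
    have -> : Re (df * g t + f t * dg) =
      minus (Re df * Re (g t) + Re (f t) * Re dg)%R
        (Im df * Im (g t) + Im (f t) * Im dg)%R.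
    { rewrite /minus /plus /opp /= /Re /Im; ring. }
    apply: is_derive_minus; apply: is_derive_mult => // n m; exact: Rmult_comm.
  - apply: (is_derive_ext
      (fun s => plus (Re (f s) * Im (g s))%R (Im (f s) * Re (g s))%R)) => //.
    have -> : Im (df * g t + f t * dg) =
      plus (Re df * Im (g t) + Re (f t) * Im dg)%R
        (Im df * Re (g t) + Im (f t) * Re dg)%R.
    { rewrite /minus /plus /opp /= /Re /Im; ring. }
    apply: is_derive_plus; apply: is_derive_mult => // n m; exact: Rmult_comm.
Qed.

(** Caratheodory's form of differentiability: a slope that is continuous at the
    base point.  It turns estimates on difference quotients into identities
    between slopes. *)
Lemma is_derive_slope (f : R -> R) (t l : R) :
  is_derive f t l <->
  exists q : R -> R,
    [/\ continuous q t, q t = l & forall s, (f s - f t = (s - t) * q s)%R].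
Proof.
  rewrite is_derive_Reals; split.
  - move=> H.
    pose q s := if Req_EM_T s t then l else ((f s - f t) / (s - t))%R.
    have qt : q t = l by rewrite /q; case: (Req_EM_T t t).
    exists q; split=> //.
    + apply/filterlim_locally => eps; rewrite qt.
      have [d Hd] := H eps (cond_pos eps).
      exists d => s Hs; rewrite /q; case: (Req_EM_T s t) => [st|ne] /=.
      * exact: ball_center.
      * have := Hd (s - t)%R. have -> : (t + (s - t) = s)%R by ring.
        apply; [lra | exact: Hs].
    + move=> s; rewrite /q; case: (Req_EM_T s t) => [st|ne] /=.
      * rewrite st; ring.
      * field; lra.
  - move=> [q [qc <- qe]] eps he.
    move/filterlim_locally: qc => /(_ (mkposreal eps he)) [d Hd].
    exists d => h h0 hd. rewrite qe.
    have -> : ((t + h - t) * q (t + h) / h = q (t + h))%R by field.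
    apply: Hd. rewrite /ball /= /AbsRing_ball /abs /minus /plus /opp /=.
    by have -> : (t + h + - t = h)%R by ring.
Qed.

Lemma is_deriveC_slope (f : R -> C) (t : R) (l : C) :
  is_deriveC f t l <->
  exists q : R -> C,
    [/\ continuous q t, q t = l & forall s, f s - f t = RtoC (s - t) * q s].
Proof.
  rewrite is_deriveC_components !is_derive_slope; split.
  - move=> [[q1 [c1 e1 h1]] [q2 [c2 e2 h2]]].
    exists (fun s => (q1 s, q2 s)); split.
    + exact/continuous_C.
    + by rewrite e1 e2 -surjective_pairing.
    + move=> s; apply: injective_projections.
      * move: (h1 s); rewrite /= /Re => h; lra.
      * move: (h2 s); rewrite /= /Im => h; lra.
  - move=> [q [/continuous_C [c1 c2] <- h]]; split.
    + exists (fun s => Re (q s)); split => // s.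
      have := f_equal Re (h s); rewrite /= /Re => e; lra.
    + exists (fun s => Im (q s)); split => // s.
      have := f_equal Im (h s); rewrite /= /Im => e; lra.
Qed.

(** * The fundamental theorem of calculus on the unit interval *)

(** The hypotheses on a path give continuity relative to the unit interval only;
    composing with the retraction [clamp] onto that interval gives functions
    that are continuous on the whole line and have the same integral. *)
Definition clamp (t : R) : R := Rmax 0 (Rmin 1 t).

Lemma clamp_unit (t : R) : unit_interval (clamp t).
Proof.
  rewrite /unit_interval /clamp /Rmax /Rmin.
  case: (Rle_dec 1 t) => ? /=; case: (Rle_dec _ _) => ? /=; lra.
Qed.

Lemma clamp_id (t : R) : unit_interval t -> clamp t = t.
Proof.
  move=> [h0 h1]; rewrite /clamp /Rmax /Rmin.
  case: (Rle_dec 1 t) => ? /=; case: (Rle_dec _ _) => ? /=; lra.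
Qed.

Lemma clamp_dist (s t : R) : (Rabs (clamp s - clamp t) <= Rabs (s - t))%R.
Proof.
  rewrite /clamp /Rmax /Rmin.
  repeat destruct Rle_dec; simpl in *; split_Rabs; lra.
Qed.

Lemma continuous_clamp (V : UniformSpace) (f : R -> V) (t : R) :
  continuous_on unit_interval f -> continuous (fun s => f (clamp s)) t.
Proof.
  move=> H.
  apply: (filterlim_comp _ _ _ clamp f _ _ _ _ (H _ (clamp_unit t))) => P [d Hd].
  exists d => s Hs; apply: Hd (clamp_unit s).
  exact: Rle_lt_trans (clamp_dist s t) Hs.
Qed.

Lemma continuous_onP (V : UniformSpace) (f : R -> V) :
  continuous_on unit_interval f <-> forall t, continuous (fun s => f (clamp s)) t.
Proof.
  split=> H; first by move=> t; exact: continuous_clamp.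
  apply: (continuous_on_ext _ (fun s => f (clamp s))).
  - by move=> t /clamp_id ->.
  - exact: continuous_on_forall.
Qed.

(** With [I] the indefinite integral of [f] composed with [clamp], the function
    [F] composed with [clamp] minus [I] is continuous and has derivative 0 inside
    the interval, hence takes equal values at 0 and 1 by the mean value
    theorem.  This asks for a derivative in the open interval only, which
    is where a path has one. *)
Lemma is_RInt_derive_inside (F f : R -> R) :
  continuous_on unit_interval F -> continuous_on unit_interval f ->
  (forall t, (0 < t < 1)%R -> is_derive F t (f t)) ->
  is_RInt f 0 1 (F 1 - F 0)%R.
Proof.
  move=> cF cf dF.
  have cc t : continuous (fun s => f (clamp s)) t by exact: continuous_clamp.
  have ic a b : ex_RInt (fun s => f (clamp s)) a b
    by apply: (ex_RInt_continuous (V := R_CompleteNormedModule)) => t _.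
  have dI t : is_derive (RInt (fun s => f (clamp s)) 0) t (f (clamp t)).
  { refine (is_derive_RInt _ (RInt (fun s => f (clamp s)) 0) 0 t _ (cc t)).
    apply: filter_forall => b; exact: (RInt_correct (V := R_CompleteNormedModule)). }
  have [|t|c [_]] := MVT_gen
    (fun s => (F (clamp s) - RInt (fun s => f (clamp s)) 0 s)%R) 0 1 (fun=> 0%R).
  - rewrite Rmin_left ?Rmax_right; try lra. move=> t ht.
    have z : minus (f t) (f (clamp t)) = 0%R.
    { rewrite clamp_id; first exact: minus_eq_zero.
      rewrite /unit_interval; lra. }
    rewrite -[X in is_derive _ _ X]/0%R -[X in is_derive _ _ X]z.
    apply: is_derive_minus => //.
    apply: is_derive_ext_loc (dF t ht).
    have hp : (0 < Rmin t (1 - t))%R by apply: Rmin_pos; lra.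
    exists (mkposreal _ hp) => s.
    rewrite /ball /= /AbsRing_ball /abs /minus /plus /opp /=.
    have := Rmin_l t (1 - t); have := Rmin_r t (1 - t) => h1 h2 /Rabs_def2 h.
    rewrite clamp_id // /unit_interval; lra.
  - move=> _. apply/continuity_pt_filterlim.
    apply: (continuous_minus (V := R_NormedModule)).
    + exact: (continuous_clamp R_UniformSpace).
    + apply: ex_derive_continuous. by exists (f (clamp t)).
  - rewrite RInt_point /zero /= !clamp_id /unit_interval; try lra.
    move=> e.
    have -> : (F 1 - F 0)%R = RInt (fun s => f (clamp s)) 0 1 by lra.
    apply: (is_RInt_ext (fun s => f (clamp s))).
    + rewrite Rmin_left ?Rmax_right; try lra. move=> t ht.
      rewrite clamp_id // /unit_interval; lra.
    + exact: (RInt_correct (V := R_CompleteNormedModule)).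
Qed.

Lemma continuous_on_components (D : R -> Prop) (f : R -> C) :
  continuous_on D f ->
  continuous_on D (fun t => Re (f t)) /\ continuous_on D (fun t => Im (f t)).
Proof.
  move=> H; split=> t Dt; apply: (filterlim_comp _ _ _ f _ _ _ _ (H t Dt)).
  - rewrite (surjective_pairing (f t)); exact: continuous_fst.
  - rewrite (surjective_pairing (f t)); exact: continuous_snd.
Qed.

Lemma RIntC_derive_inside (F f : R -> C) :
  continuous_on unit_interval F -> continuous_on unit_interval f ->
  (forall t, (0 < t < 1)%R -> is_deriveC F t (f t)) ->
  RInt (V := C_R_CompleteNormedModule) f 0 1 = F 1%R - F 0%R.
Proof.
  move=> /continuous_on_components [F1 F2] /continuous_on_components [f1 f2] dF.
  apply: (is_RInt_unique (V := C_R_CompleteNormedModule)).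
  rewrite [F 1%R - F 0%R]surjective_pairing.
  apply: (is_RInt_fct_extend_pair (U := R_NormedModule) (V := R_NormedModule)).
  - apply: (is_RInt_derive_inside (fun t => Re (F t)) (fun t => Re (f t))) => //.
    by move=> t /dF /is_deriveC_components [].
  - apply: (is_RInt_derive_inside (fun t => Im (F t)) (fun t => Im (f t))) => //.
    by move=> t /dF /is_deriveC_components [].
Qed.

(** * Critical values along a path *)

(** The phase of the Pearcey integral.  At a root [w] of the cubic it equals the
    primitive [(3 x1 w + 2 x2 w ^ 2) / 4] of [w dx1 + w ^ 2 dx2]. *)
Definition phase (x : C2) (w : C) : C := w ^ 4 + x.2 * w ^ 2 + x.1 * w.

(** The cubic says that the derivative of the phase in [w] vanishes. *)
Definition critical (x : C2) (w : C) : Prop := 4 * w ^ 3 + 2 * x.2 * w + x.1 = 0.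

Lemma locally_neq0 (f : R -> C) (t : R) :
  continuous f t -> f t <> 0 -> locally t (fun s => f s <> 0).
Proof.
  move=> fc f0.
  pose h s := (Re (f s) * Re (f s) + Im (f s) * Im (f s))%R.
  have hpos : (0 < h t)%R.
  { have : h t <> 0%R.
    { rewrite /h => e. apply: f0; rewrite (surjective_pairing (f t)).
      congr pair; rewrite /Re /Im in e; nra. }
    rewrite /h; nra. }
  have [f1 f2] := proj1 (continuous_C _ _ _) fc.
  have hc : continuous h t.
  { apply: (continuous_plus (V := R_NormedModule));
      exact: (continuous_mult (K := R_AbsRing)). }
  have hl : locally t (fun s => 0 < h s)%R := hc _ (open_gt 0 _ hpos).
  apply: filter_imp hl => s hs e.
  move: hs; rewrite /h e /=; lra.
Qed.

Ltac Ccont := repeat first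
  [ assumption
  | exact: continuous_const
  | apply: continuous_Cplus
  | apply: (continuous_opp (V := C_R_NormedModule))
  | apply: continuous_Cmult ].

(** How far a continuous root moves when [x] moves by [O(s - t)].  The
    hypothesis is the difference of the cubic at times [s] and [t], where [A] is
    its derivative at [w t].  If [w t] is a simple root ([A] is not 0) then the
    displacement is [O(s - t)]; if it is double, its square is; if it is triple,
    which forces [w t = 0], its cube is.  In each case the quantity in the
    conclusion, which is the part of the phase increment that the cubic does not
    control, is [o(s - t)]. *)
Lemma critical_displacement (w e : R -> C) (t : R) (A : C) :
  continuous w t -> continuous e t ->
  locally t (fun s =>
    (w s - w t) * (A + 12 * w t * (w s - w t) + 4 * (w s - w t) ^ 2)
      = RtoC (s - t) * e s) ->
  exists m : R -> C,
    [/\ continuous m t, m t = 0 &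
        locally t (fun s =>
          (w s - w t) ^ 3 * (w s + w t) = RtoC (s - t) * m s)].
Proof.
  move=> wc ec H.
  have [A0|A0] := Ceq_dec A 0; first have [w0|w0] := Ceq_dec (w t) 0.
  - exists (fun s => w s * e s / 4); split.
    + by rewrite /Cdiv; Ccont.
    + rewrite w0; Cfield.
    + apply: filter_imp H => s; rewrite A0 w0 => H.
      transitivity (w s * (RtoC (s - t) * e s) / 4).
      * rewrite -H; Cfield.
      * Cfield.
  - exists (fun s => (w s - w t) * e s * (w s + w t) / (12 * w t + 4 * (w s - w t))).
    have nz : 12 * w t + 4 * (w t - w t) <> 0.
    { have -> : 12 * w t + 4 * (w t - w t) = 12 * w t by ring.
      apply: Cmult_neq_0 => //; move/RtoC_inj; lra. }
    have dc : continuous (fun s => 12 * w t + 4 * (w s - w t)) t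
      by rewrite /Cminus; Ccont.
    split.
    + rewrite /Cdiv; apply: continuous_Cmult; first by rewrite /Cminus; Ccont.
      exact: continuous_Cinv.
    + field; exact: nz.
    + apply: filter_imp (filter_and _ _ H (locally_neq0 _ _ dc nz))
        => s [{}H ns]; rewrite A0 in H.
      transitivity ((w s - w t) * (RtoC (s - t) * e s) * (w s + w t)
                    / (12 * w t + 4 * (w s - w t))).
      * rewrite -H; field; exact: ns.
      * field; exact: ns.
  - pose E s := A + 12 * w t * (w s - w t) + 4 * (w s - w t) ^ 2.
    exists (fun s => (w s - w t) ^ 2 * (w s + w t) * e s / E s).
    have nz : E t <> 0.
    { by have -> : E t = A by rewrite /E; ring. }
    have dc : continuous E t by rewrite /E /Cminus /=; Ccont.
    split.
    + rewrite /Cdiv; apply: continuous_Cmult; first by rewrite /Cminus /=; Ccont.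
      exact: continuous_Cinv.
    + field; exact: nz.
    + apply: filter_imp (filter_and _ _ H (locally_neq0 _ _ dc nz))
        => s [{}H ns]; rewrite -/(E s) in H.
      transitivity ((w s - w t) ^ 2 * (w s + w t) * (RtoC (s - t) * e s) / E s).
      * rewrite -H; field; exact: ns.
      * field; exact: ns.
Qed.

(** The envelope theorem for the phase: along the path only the explicit
    dependence on [x] contributes to the derivative of the critical value,
    because the derivative of the phase in [w] vanishes there.  It has to hold
    when roots collide, where [w] need not be differentiable, since a C^1 path
    may meet the turning set in an arbitrary closed set of times;
    [critical_displacement] bounds the contribution of the motion of [w]. *)
Lemma is_deriveC_critical_value (g : R -> C2) (w : R -> C) (t : R) (d : C2) :
  is_deriveC (fun s => (g s).1) t d.1 -> is_deriveC (fun s => (g s).2) t d.2 ->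
  continuous w t -> locally t (fun s => critical (g s) (w s)) ->
  is_deriveC (fun s => phase (g s) (w s)) t (pairing (omega (w t)) d).
Proof.
  case: d => d1 d2 /=.
  move=> /is_deriveC_slope [q1 [q1c <- h1]] /is_deriveC_slope [q2 [q2c <- h2]] wc cr.
  have crt := locally_singleton _ _ cr.
  pose A := 12 * w t ^ 2 + 2 * (g t).2.
  pose e s := - (2 * q2 s * w s + q1 s).
  have ec : continuous e t by rewrite /e; Ccont.
  have disp : locally t (fun s =>
    (w s - w t) * (A + 12 * w t * (w s - w t) + 4 * (w s - w t) ^ 2)
      = RtoC (s - t) * e s).
  { apply: filter_imp cr => s; rewrite /critical => crs.
    have -> : RtoC (s - t) * e s =
      - (2 * (RtoC (s - t) * q2 s) * w s + RtoC (s - t) * q1 s)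
      by rewrite /e; ring.
    rewrite -h1 -h2.
    transitivity ((4 * w s ^ 3 + 2 * (g s).2 * w s + (g s).1)
      - (4 * w t ^ 3 + 2 * (g t).2 * w t + (g t).1)
      - (2 * ((g s).2 - (g t).2) * w s + ((g s).1 - (g t).1))).
    { rewrite /A; ring. }
    rewrite crs crt; ring. }
  (* Taylor expansion of the phase in [w] at [w t] up to degree 4; half of [disp]
     times the displacement absorbs the quadratic term, and [m] takes the rest. *)
  have [m [mc m0 hm]] := critical_displacement w e t A wc ec disp.
  pose q s := w s ^ 2 * q2 s + w s * q1 s + (w s - w t) * e s / 2 - m s.
  have dq : is_deriveC (fun s => phase (g t) (w t) + RtoC (s - t) * q s) t
      (pairing (omega (w t)) (q1 t, q2 t)).
  { apply/is_deriveC_slope; exists q; split.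
    - by rewrite /q /Cminus /Cdiv /=; Ccont.
    - rewrite /q m0 /pairing /omega /=; Cfield.
    - move=> s. rewrite Rminus_eq_0; ring. }
  apply: is_derive_ext_loc dq.
  apply: filter_imp (filter_and _ _ (filter_and _ _ disp hm) cr)
    => s [[{}disp {}hm] crs].
  have -> : RtoC (s - t) * q s =
     w s ^ 2 * (RtoC (s - t) * q2 s) + w s * (RtoC (s - t) * q1 s)
     + (w s - w t) * (RtoC (s - t) * e s) / 2 - RtoC (s - t) * m s
    by rewrite /q; Cfield.
  rewrite -h1 -h2 -hm -disp /phase /A.
  have -> : (g t).1 = - (4 * w t ^ 3 + 2 * (g t).2 * w t).
  { move: crt; rewrite /critical => crt.
    transitivity ((4 * w t ^ 3 + 2 * (g t).2 * w t + (g t).1)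
       - (4 * w t ^ 3 + 2 * (g t).2 * w t)); first ring.
    rewrite crt; ring. }
  match goal with |- ?a = ?b => change (@eq C a b) end; Cfield.
Qed.

(** * Root triples *)

Definition of_roots (r : label -> C) : C2 :=
  (- 4 * (r l1 * r l2 * r l3), 2 * (r l1 * r l2 + r l2 * r l3 + r l3 * r l1)).

Lemma last_root (r : label -> C) :
  r l1 + r l2 + r l3 = 0 -> r l3 = - (r l1 + r l2).
Proof.
  move=> s; transitivity (r l1 + r l2 + r l3 - (r l1 + r l2)); first ring.
  rewrite s; ring.
Qed.

(** Vieta's formulas, read off from the values at 0, 1 and -1.  The space of
    triples with sum 0 thus parametrizes all points [x] together with a
    numbering of the roots. *)
Lemma root_tripleP (x : C2) (r : label -> C) :
  root_triple x r <-> r l1 + r l2 + r l3 = 0 /\ x = of_roots r.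
Proof.
  case: x => x1 x2; rewrite /root_triple /of_roots /=; split.
  - move=> H.
    have e : x1 = - 4 * (r l1 * r l2 * r l3).
    { transitivity (4 * 0 ^ 3 + 2 * x2 * 0 + x1); first ring.
      rewrite (H 0); ring. }
    split.
    + transitivity (- ((4 * (1 - r l1) * (1 - r l2) * (1 - r l3)
        + 4 * (- (1) - r l1) * (- (1) - r l2) * (- (1) - r l3))
        + 8 * (r l1 * r l2 * r l3)) / 8); first by Cfield.
      rewrite -!H e; Cfield.
    + rewrite -e; congr pair.
      transitivity (((4 * 1 ^ 3 + 2 * x2 * 1 + x1)
        - (4 * (- (1)) ^ 3 + 2 * x2 * (- (1)) + x1) - 8) / 4); first by Cfield.
      rewrite !H; Cfield.
  - move=> [s [-> ->]] w.
    rewrite (last_root r s); ring.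
Qed.

Lemma root_triple_critical (x : C2) (r : label -> C) (j : label) :
  root_triple x r -> critical x (r j).
Proof. by rewrite /critical => ->; case: j; ring. Qed.

Definition third (l k : label) : label :=
  match l, k with
  | l1, l2 | l2, l1 => l3
  | l1, l3 | l3, l1 => l2
  | _, _ => l1
  end.

(** The exponent 3 explains the Stokes geometry near a double root: the
    difference of critical values vanishes to order 3/2 in [x]. *)
Lemma phase_diff (x : C2) (r : label -> C) (l k : label) :
  root_triple x r -> l <> k ->
  phase x (r l) - phase x (r k) = r (third l k) * (r l - r k) ^ 3.
Proof.
  move=> /root_tripleP [s ->] lk.
  have e3 := last_root r s.
  by case: l k lk => [] [] // _; rewrite /phase /of_roots /= !e3; ring.
Qed.

(** * Integrals along paths *)

(** The integral depends only on the endpoints and on the roots there, so no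
    monodromy has to be followed. *)
Lemma int_omega_diff_phase (a b : C2) (g dg : R -> C2) (z : R -> label -> C)
    (l k : label) :
  C1_path a b g dg -> root_branches g z ->
  int_omega_diff dg z l k =
    (phase b (z 1%R l) - phase b (z 1%R k))
    - (phase a (z 0%R l) - phase a (z 0%R k)).
Proof.
  move=> [<- <- /continuous_onP gc /continuous_onP dgc gd] [zr zc].
  have {}gc t := proj1 (continuous_components _ _ _ _ _) (gc t).
  have {}dgc t := proj1 (continuous_components _ _ _ _ _) (dgc t).
  have {}zc j := proj1 (continuous_onP _ _) (zc j).
  pose D t := phase (g t) (z t l) - phase (g t) (z t k).
  rewrite /int_omega_diff (RIntC_derive_inside D) //.
  - apply/continuous_onP => t; rewrite /D /phase.
    have [g1 g2] := gc t; have hl := zc l t; have hk := zc k t.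
    by rewrite /Cminus /=; Ccont.
  - apply/continuous_onP => t; rewrite /pairing /covector_sub /omega /=.
    have [g1 g2] := dgc t; have hl := zc l t; have hk := zc k t.
    by rewrite /Cminus /=; Ccont.
  - move=> t ht; have [d1 d2] := gd t ht.
    have inside : locally t unit_interval.
    { apply: filter_imp (open_and _ _ (open_gt 0) (open_lt 1) t ht) => s [h0 h1].
      by split; apply: Rlt_le. }
    have dz j : is_deriveC (fun s => phase (g s) (z s j)) t
        (pairing (omega (z t j)) (dg t)).
    { apply: is_deriveC_critical_value => //.
      - exact: continuous_continuous_on inside (proj2 (continuous_onP _ _) (zc j)).
      - apply: filter_imp inside => s /zr; exact: root_triple_critical. }
    have -> : pairing (covector_sub (omega (z t l)) (omega (z t k))) (dg t) =
      pairing (omega (z t l)) (dg t) - pairing (omega (z t k)) (dg t)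
      by rewrite /pairing /covector_sub /=; ring.
    exact: (is_derive_minus (V := C_R_NormedModule)).
Qed.

(** The triple (1, 1, -2), with the label [m] on the simple root: a turning point
    away from the origin at which any two prescribed branches meet. *)
Definition collided (m j : label) : C :=
  match m, j with
  | l1, l1 | l2, l2 | l3, l3 => - (2)
  | _, _ => 1
  end.

Lemma collided_third (l k : label) :
  l <> k -> collided (third l k) l = 1 /\ collided (third l k) k = 1.
Proof. by case: l k => [] []. Qed.

Lemma collided_sum (m : label) : collided m l1 + collided m l2 + collided m l3 = 0.
Proof. by case: m => /=; ring. Qed.

Lemma is_deriveC_eq (f : R -> C) (t : R) (d d' : C) :
  is_deriveC f t d -> d = d' -> is_deriveC f t d'.
Proof. by move=> H <-. Qed.

(** A line segment in the space of root triples gives a path in [C2] that carries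
    its continuous branches with it. *)
Lemma C1_of_roots (s v : label -> C) (z : R -> label -> C) :
  (forall t j, z t j = s j + RtoC t * v j) ->
  exists dg, C1_path (of_roots (z 0%R)) (of_roots (z 1%R)) (fun t => of_roots (z t)) dg
    /\ forall j, continuous_on unit_interval (fun t => z t j).
Proof.
  move=> ze.
  have zd j t : is_deriveC (fun t => z t j) t (v j).
  { apply/is_deriveC_slope; exists (fun=> v j); split=> //.
    - exact: continuous_const.
    - move=> t'; rewrite !ze RtoC_minus; ring. }
  have zc j t : continuous (fun t => z t j) t
    by apply: ex_derive_continuous; exists (v j).
  have cd (c : C) t : is_deriveC (fun=> c) t (RtoC 0) by exact: is_derive_const.
  exists (fun t =>
    (- 4 * ((v l1 * z t l2 + z t l1 * v l2) * z t l3 + z t l1 * z t l2 * v l3),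
     2 * ((v l1 * z t l2 + z t l1 * v l2) + (v l2 * z t l3 + z t l2 * v l3)
          + (v l3 * z t l1 + z t l3 * v l1)))).
  split; first split=> //.
  - apply: continuous_on_forall => t _.
    have h1 := zc l1 t; have h2 := zc l2 t; have h3 := zc l3 t.
    by apply/continuous_components; split; rewrite /=; Ccont.
  - apply: continuous_on_forall => t _.
    have h1 := zc l1 t; have h2 := zc l2 t; have h3 := zc l3 t.
    by apply/continuous_components; split; rewrite /=; Ccont.
  - move=> t _; split; rewrite /=.
    + apply: is_deriveC_eq.
      * apply: is_deriveC_mult; first exact: cd.
        by apply: is_deriveC_mult => //; apply: is_deriveC_mult.
      * cbv beta; ring.
    + apply: is_deriveC_eq.
      * apply: is_deriveC_mult; first exact: cd.
        apply: is_deriveC_plus; last by apply: is_deriveC_mult.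
        by apply: is_deriveC_plus; apply: is_deriveC_mult.
      * cbv beta; ring.
  - move=> j; apply: continuous_on_forall => t _; exact: zc.
Qed.

(** * Stokes surfaces *)

(** From left to right, the two critical values agree at the turning point, so
    the integral is their difference at [x].  From right to left, [x] is joined
    to the turning point with roots (1, 1, -2) by a segment in the space of root
    triples; this works for every [x] and every pair of branches, the origin
    included. *)
Lemma stokes_surfaceP (zeta : C2 -> label -> C) (l k : label) (x : C2) :
  (forall y, root_triple y (zeta y)) -> l <> k ->
  (exists tau : C2, (turning_point tau /\ tau <> (RtoC 0, RtoC 0)) /\
     stokes_surface_type zeta tau l k x) <->
  Im (phase x (zeta x l) - phase x (zeta x k)) = 0%R.
Proof.
  move=> zetaP lk; split.
  - move=> [tau [_ [g [dg [z [gp zb z1 [_ tp] im]]]]]].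
    have z0 : z 0%R l = z 0%R k by case: tp.
    move: im; rewrite (int_omega_diff_phase _ _ _ _ _ _ _ gp zb) !z1 z0.
    by move=> <-; congr Im; ring.
  - move=> im.
    have [sx ex] := proj1 (root_tripleP _ _) (zetaP x).
    have [sl sk] := collided_third l k lk.
    have ss := collided_sum (third l k).
    set s := collided (third l k) in sl sk ss.
    pose z t j := s j + RtoC t * (zeta x j - s j).
    have z0 j : z 0%R j = s j by rewrite /z; ring.
    have z1 j : z 1%R j = zeta x j by rewrite /z; ring.
    have zt t : root_triple (of_roots (z t)) (z t).
    { apply/root_tripleP; split=> //; rewrite /z.
      transitivity ((1 - RtoC t) * (s l1 + s l2 + s l3)
        + RtoC t * (zeta x l1 + zeta x l2 + zeta x l3)); first ring.
      rewrite ss sx; ring. }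
    have tt : turning_type (z 0%R) l k by split=> //; rewrite !z0 sl sk.
    have [dg [gp zc]] := C1_of_roots s (fun j => zeta x j - s j) z (fun _ _ => erefl).
    have e1 : of_roots (z 1%R) = x by rewrite ex /of_roots !z1.
    rewrite e1 in gp.
    exists (of_roots (z 0%R)); split; first split.
    + by exists (z 0%R), l, k.
    + (* the first coordinate is -4 * (1 * 1 * -2) = 8 *)
      move=> /(f_equal fst) /=; rewrite !z0 /s => e.
      have : Re (- 4 * (s l1 * s l2 * s l3)) = 8%R
        by rewrite /s; case: (third l k) => /=; ring.
      rewrite /s e /=; lra.
    + exists (fun t => of_roots (z t)), dg, z; split=> //.
      have zb : root_branches (fun t => of_roots (z t)) z by split.
      rewrite (int_omega_diff_phase _ _ _ _ _ _ _ gp zb) !z1 !z0 sl sk -im.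
      congr Im; ring.
Qed.

Lemma stokes_setP (zeta : C2 -> label -> C) (x : C2) :
  (forall y, root_triple y (zeta y)) ->
  stokes_set zeta x <->
  exists l k : label, l <> k /\ Im (phase x (zeta x l) - phase x (zeta x k)) = 0%R.
Proof.
  move=> zetaP; split.
  - move=> [tau [tp t0 [l [k st]]]].
    have lk : l <> k by case: st => [g [dg [z [_ _ _ []]]]].
    exists l, k; split=> //; apply/(stokes_surfaceP _ _ _ _ zetaP lk).
    by exists tau.
  - move=> [l [k [lk /(stokes_surfaceP _ _ _ _ zetaP lk) [tau [[tp t0] st]]]]].
    by exists tau; split=> //; exists l, k.
Qed.

(** Two different pairs of labels cover all three, so two equal imaginary parts
    force the third: the condition does not depend on the pairs, nor on the
    numbering of the roots. *)
Lemma self_intersectionP (zeta : C2 -> label -> C) (l k l' k' : label) (x : C2) :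
  (forall y, root_triple y (zeta y)) ->
  l <> k -> l' <> k' -> ~ same_type l k l' k' ->
  self_intersection zeta l k l' k' x <->
  forall i j : label, Im (phase x (zeta x i) - phase x (zeta x j)) = 0%R.
Proof.
  move=> zetaP lk lk' ns; split.
  - move=> [tau [tau' [h h' st st']]].
    have im : Im (phase x (zeta x l) - phase x (zeta x k)) = 0%R
      by apply/(stokes_surfaceP _ _ _ _ zetaP lk); exists tau.
    have im' : Im (phase x (zeta x l') - phase x (zeta x k')) = 0%R
      by apply/(stokes_surfaceP _ _ _ _ zetaP lk'); exists tau'.
    pose y i := Im (phase x (zeta x i)).
    have dy i j : Im (phase x (zeta x i) - phase x (zeta x j)) = (y i - y j)%R by [].
    move=> i j; rewrite !dy in im im' *.
    move: y {dy} lk lk' ns im im' {st st'} => y.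
    rewrite /same_type.
    case: l k l' k' i j => [] [] [] [] [] [] lk lk' ns im im';
      by [lra | case: lk | case: lk' | case: ns; left | case: ns; right].
  - move=> im.
    have [tau [h st]] := proj2 (stokes_surfaceP _ _ _ _ zetaP lk) (im l k).
    have [tau' [h' st']] := proj2 (stokes_surfaceP _ _ _ _ zetaP lk') (im l' k').
    by exists tau, tau'.
Qed.

(** * The sextic *)

(** The sextic is [16 * ((F * (F ^ 2 + P)) ^ 2 + Q)] with the following [P] and
    [Q]. *)
Definition stokesP (x : C2) : C := x.2 * (27 * x.1 ^ 2 - x.2 ^ 3).

Definition stokesQ (x : C2) : C :=
  x.1 ^ 2 * (27 * x.1 ^ 2 + 8 * x.2 ^ 3) ^ 3 / 16.

(** The factor 4 is chosen for the sextic: with it, the product of all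
    differences [F - gap] has the right constant term. *)
Definition gap (x : C2) (r : label -> C) (l k : label) : C :=
  4 * (phase x (r l) - phase x (r k)).

Lemma gap_sum (x : C2) (r : label -> C) :
  gap x r l3 l1 = - (gap x r l1 l2 + gap x r l2 l3).
Proof. rewrite /gap; ring. Qed.

(** The three gaps have sum 0 and are the roots of the cubic [F ^ 3 + P F + q],
    where [q ^ 2 = - Q]; the opposite gaps are the roots of
    [F ^ 3 + P F - q]. *)
Lemma gap_coefficients (x : C2) (r : label -> C) :
  root_triple x r ->
  let D1 := gap x r l1 l2 in let D2 := gap x r l2 l3 in let D3 := gap x r l3 l1 in
  stokesP x = D1 * D2 + D2 * D3 + D3 * D1 /\ stokesQ x = - (D1 * D2 * D3) ^ 2.
Proof.
  move=> rx /=; rewrite /gap !(phase_diff _ _ _ _ rx) //=.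
  move: rx => /root_tripleP [s ->].
  have e3 := last_root r s.
  rewrite /stokesP /stokesQ /of_roots /= !e3; split; first ring.
  Cfield.
Qed.

Lemma stokes_eq_cubic (x : C2) (F : C) :
  stokes_eq x F <-> (F * (F ^ 2 + stokesP x)) ^ 2 + stokesQ x = 0.
Proof.
  have E : 16 * ((F * (F ^ 2 + stokesP x)) ^ 2 + stokesQ x) =
    16 * F ^ 6 + 32 * x.2 * (27 * x.1 ^ 2 - x.2 ^ 3) * F ^ 4
    + 16 * x.2 ^ 2 * (27 * x.1 ^ 2 - x.2 ^ 3) ^ 2 * F ^ 2
    + x.1 ^ 2 * (27 * x.1 ^ 2 + 8 * x.2 ^ 3) ^ 3.
  { rewrite /stokesQ /stokesP; Cfield. }
  have -> : stokes_eq x F = (16 * ((F * (F ^ 2 + stokesP x)) ^ 2 + stokesQ x) = 0)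
    by rewrite E.
  split=> [/Cmult_eq0 [/RtoC_inj|//]|->]; first lra.
  exact: Cmult_0_r.
Qed.

Lemma stokes_eqP (x : C2) (r : label -> C) (F : C) :
  root_triple x r ->
  stokes_eq x F <-> exists l k : label, l <> k /\ F = gap x r l k.
Proof.
  move=> rx; have [eP eQ] := gap_coefficients x r rx.
  have E : (F * (F ^ 2 + stokesP x)) ^ 2 + stokesQ x =
    (F - gap x r l1 l2) * (F - gap x r l2 l1) * ((F - gap x r l2 l3) * (F - gap x r l3 l2))
       * ((F - gap x r l3 l1) * (F - gap x r l1 l3)).
  { rewrite eP eQ gap_sum /gap; ring. }
  rewrite stokes_eq_cubic E {E eP eQ}.
  have sub0 a : F - a = 0 -> F = a.
  { move=> e; transitivity (F - a + a); first ring. rewrite e; ring. }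
  split.
  - move=> /Cmult_eq0 [/Cmult_eq0 []|] /Cmult_eq0 [] /sub0 e.
    + by exists l1, l2.
    + by exists l2, l1.
    + by exists l2, l3.
    + by exists l3, l2.
    + by exists l3, l1.
    + by exists l1, l3.
  - move=> [l [k [lk ->]]]; case: l k lk => [] [] // _; ring.
Qed.

Lemma Im_gap (x : C2) (r : label -> C) (l k : label) :
  Im (gap x r l k) = 0%R <-> Im (phase x (r l) - phase x (r k)) = 0%R.
Proof.
  rewrite /gap; set d := _ - _; rewrite /Im /=; split; lra.
Qed.

Lemma stokes_set_eq (zeta : C2 -> label -> C) (x : C2) :
  (forall y, root_triple y (zeta y)) ->
  stokes_set zeta x <-> exists F : C, stokes_eq x F /\ Im F = 0%R.
Proof.
  move=> zetaP; rewrite (stokes_setP _ _ zetaP); split.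
  - move=> [l [k [lk /Im_gap im]]]; exists (gap x (zeta x) l k); split=> //.
    by apply/(stokes_eqP _ _ _ (zetaP x)); exists l, k.
  - move=> [F [/(stokes_eqP _ _ _ (zetaP x)) [l [k [lk ->]]] /Im_gap im]].
    by exists l, k.
Qed.

(** * Semialgebraic sets *)

Definition polynomial_fun {n : nat} (f : ('I_n -> R) -> R) : Prop :=
  exists p : {mpoly R[n]}, forall v, meval v p = f v.

Lemma polynomial_const (n : nat) (c : R) : polynomial_fun (fun _ : 'I_n -> R => c).
Proof. by exists (mpolyC n c) => v; exact: mevalC. Qed.

Lemma polynomial_coord (n : nat) (i : 'I_n) : polynomial_fun (fun v : 'I_n -> R => v i).
Proof. by exists ('X_i) => v; exact: mevalXU. Qed.

Lemma polynomial_plus (n : nat) (f g : ('I_n -> R) -> R) :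
  polynomial_fun f -> polynomial_fun g -> polynomial_fun (fun v => f v + g v)%R.
Proof.
  move=> [p hp] [q hq]; exists (GRing.add p q) => v.
  by rewrite -hp -hq; exact: mevalD.
Qed.

Lemma polynomial_opp (n : nat) (f : ('I_n -> R) -> R) :
  polynomial_fun f -> polynomial_fun (fun v => - f v)%R.
Proof.
  move=> [p hp]; exists (GRing.opp p) => v.
  by rewrite -hp; exact: mevalN.
Qed.

Lemma polynomial_mult (n : nat) (f g : ('I_n -> R) -> R) :
  polynomial_fun f -> polynomial_fun g -> polynomial_fun (fun v => f v * g v)%R.
Proof.
  move=> [p hp] [q hq]; exists (GRing.mul p q) => v.
  by rewrite -hp -hq; exact: mevalM.
Qed.

Definition polynomial_funC {n : nat} (f : ('I_n -> R) -> C) : Prop :=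
  polynomial_fun (fun v => Re (f v)) /\ polynomial_fun (fun v => Im (f v)).

Ltac polynomial := repeat first
  [ assumption
  | apply: polynomial_plus
  | apply: polynomial_opp
  | apply: polynomial_mult
  | apply: polynomial_coord
  | exact: polynomial_const ].

Lemma polynomialC_const (n : nat) (c : C) : polynomial_funC (fun _ : 'I_n -> R => c).
Proof. by split; exact: polynomial_const. Qed.

Lemma polynomialC_plus (n : nat) (f g : ('I_n -> R) -> C) :
  polynomial_funC f -> polynomial_funC g -> polynomial_funC (fun v => f v + g v).
Proof. by move=> [f1 f2] [g1 g2]; split; rewrite /=; polynomial. Qed.

Lemma polynomialC_opp (n : nat) (f : ('I_n -> R) -> C) :
  polynomial_funC f -> polynomial_funC (fun v => - f v).
Proof. by move=> [f1 f2]; split; rewrite /=; polynomial. Qed.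

Lemma polynomialC_mult (n : nat) (f g : ('I_n -> R) -> C) :
  polynomial_funC f -> polynomial_funC g -> polynomial_funC (fun v => f v * g v).
Proof. by move=> [f1 f2] [g1 g2]; split; rewrite /=; polynomial. Qed.

Lemma semialgebraic_ext (n : nat) (A B : ('I_n -> R) -> Prop) :
  (forall v, A v <-> B v) -> semialgebraic A -> semialgebraic B.
Proof. by move=> AB [s hs]; exists s => v; rewrite -AB. Qed.

Lemma semialgebraic_eq0 (n : nat) (f : ('I_n -> R) -> R) :
  polynomial_fun f -> semialgebraic (fun v => f v = 0%R).
Proof.
  move=> [p hp]; exists [:: ([:: p], [::])] => v.
  rewrite List.Exists_cons List.Exists_nil /= List.Forall_cons_iff hp.
  split=> [h|[[[]]|]] //; by left.
Qed.

Lemma semialgebraic_gt0 (n : nat) (f : ('I_n -> R) -> R) :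
  polynomial_fun f -> semialgebraic (fun v => 0 < f v)%R.
Proof.
  move=> [p hp]; exists [:: ([::], [:: p])] => v.
  rewrite List.Exists_cons List.Exists_nil /= List.Forall_cons_iff hp.
  split=> [h|[[_ []]|]] //; by left.
Qed.

Lemma semialgebraic_or (n : nat) (A B : ('I_n -> R) -> Prop) :
  semialgebraic A -> semialgebraic B -> semialgebraic (fun v => A v \/ B v).
Proof.
  move=> [s hs] [t ht]; exists (s ++ t) => v.
  by rewrite List.Exists_app hs ht.
Qed.

(** An intersection of unions is the union of the pairwise intersections. *)
Lemma semialgebraic_and (n : nat) (A B : ('I_n -> R) -> Prop) :
  semialgebraic A -> semialgebraic B -> semialgebraic (fun v => A v /\ B v).
Proof.
  move=> [s hs] [t ht].
  exists (List.map (fun ab => (ab.1.1 ++ ab.2.1, ab.1.2 ++ ab.2.2))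
           (List.list_prod s t)) => v.
  rewrite hs ht List.Exists_map !List.Exists_exists; split.
  - move=> [[a [sa [a1 a2]]] [b [tb [b1 b2]]]].
    exists (a, b); rewrite List.in_prod_iff /= !List.Forall_app; tauto.
  - move=> [[a b] []]; rewrite List.in_prod_iff /= !List.Forall_app.
    move=> [sa tb] [[a1 b1] [a2 b2]].
    by split; [exists a | exists b].
Qed.

Lemma semialgebraic_ge0 (n : nat) (f : ('I_n -> R) -> R) :
  polynomial_fun f -> semialgebraic (fun v => 0 <= f v)%R.
Proof.
  move=> pf; apply: (semialgebraic_ext _ (fun v => 0 < f v \/ f v = 0)%R).
  - move=> v; split; lra.
  - by apply: semialgebraic_or; [exact: semialgebraic_gt0 | exact: semialgebraic_eq0].
Qed.

Lemma semialgebraic_neq0 (n : nat) (f : ('I_n -> R) -> R) :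
  polynomial_fun f -> semialgebraic (fun v => f v <> 0%R).
Proof.
  move=> pf; apply: (semialgebraic_ext _ (fun v => 0 < f v * f v)%R).
  - move=> v; split; last exact: Rsqr_pos_lt.
    by move=> h e; move: h; rewrite e; lra.
  - by apply: semialgebraic_gt0; polynomial.
Qed.

(** * Real elimination *)

(** Elimination of a real nonnegative root [y] of [y (y + P) ^ 2 + Q], with
    [P = p1 + i p2] and [Q = q1 + i q2].  If [p2 = 0] the imaginary part says
    [q2 = 0], and the real part [y (y + p1) ^ 2 + q1] takes the value 0 on the
    half-line exactly when its value [q1] at 0 is nonpositive.  If [p2] is not 0,
    the imaginary part is a quadratic equation, and reducing the real part modulo
    it leaves the linear equation [y S = N].  For [S <> 0] this determines [y];
    for [S = N = 0] the quadratic becomes [y ^ 2 + p1 y - p2 ^ 2 = 0], which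
    always has a nonnegative root. *)
Lemma ex_nonneg_root (p1 p2 q1 q2 : R) :
  (exists y : R, (0 <= y)%R /\ (y * ((y + p1) ^ 2 - p2 ^ 2) + q1 = 0)%R /\
     (2 * y * (y + p1) * p2 + q2 = 0)%R) <->
  (p2 = 0 /\ q2 = 0 /\ 0 <= - q1)%R \/
  (p2 <> 0 /\
   let S := 2 * p2 * p2 * p2 + q2 in let N := 2 * p2 * q1 - p1 * q2 in
   (S <> 0 /\ 0 <= N * S /\ 2 * p2 * (N * N + p1 * N * S) + q2 * S * S = 0) \/
   (S = 0 /\ N = 0))%R.
Proof.
  split.
  - move=> [y [y0 [e1 e2]]].
    have [z|nz] := Req_dec p2 0; [left|right].
    + subst p2; split=> //; split; first lra.
      have h := Rmult_le_pos _ _ y0 (pow2_ge_0 (y + p1)).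
      have e : (y * ((y + p1) ^ 2 - 0 ^ 2) = y * (y + p1) ^ 2)%R by ring.
      lra.
    + split=> //=.
      set S := (_ + q2)%R; set N := (_ - p1 * q2)%R.
      have eN : (y * S = N)%R.
      { rewrite /S /N.
        have -> : q2 = (- (2 * y * (y + p1) * p2))%R by lra.
        have -> : q1 = (- (y * ((y + p1) ^ 2 - p2 ^ 2)))%R by lra.
        ring. }
      have [S0|S0] := Req_dec S 0; [right|left].
      * by rewrite -eN S0; lra.
      * split=> //; rewrite -eN; split; first nra.
        transitivity (S * S * (2 * y * (y + p1) * p2 + q2))%R; first ring.
        rewrite e2; ring.
  - move=> [[-> [-> q0]]|[nz /=]].
    + (* [M + p1 >= 1] and [M >= - q1], so that [f M >= 0] *)
      pose f y := (y * (y + p1) ^ 2 + q1)%R.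
      pose M := (1 + Rabs p1 - q1)%R.
      have hM : (0 <= f M)%R.
      { have := Rle_abs (- p1)%R; rewrite Rabs_Ropp => h.
        have h' := Rabs_pos p1.
        have : (1 <= (M + p1) * (M + p1))%R by rewrite /M; nra.
        rewrite /f /M => k; nra. }
      have fc : continuity f by rewrite /f; reg.
      have [||y [hy fy]] := IVT_gen f 0 M 0%R => //.
      { rewrite Rmin_left ?Rmax_right; rewrite /f in hM *; nra. }
      have M0 : (0 <= M)%R by rewrite /M; have := Rabs_pos p1; lra.
      exists y; rewrite Rmin_left // in hy; split; first lra.
      rewrite /f in fy; split; lra.
    + set S := (_ + q2)%R; set N := (_ - p1 * q2)%R.
      move=> [[S0 [NS e]]|[S0 N0]].
      * have eN : (N / S * S = N)%R by field.
        set y := (N / S)%R in eN.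
        have y0 : (0 <= y)%R.
        { apply: Rmult_le_reg_r (_ : 0 < S * S)%R _; nra. }
        have e2 : (2 * y * (y + p1) * p2 + q2 = 0)%R.
        { apply: (Rmult_eq_reg_l (S * S)%R); last nra.
          rewrite -eN in e. rewrite Rmult_0_r -e; ring. }
        exists y; split=> //; split=> //.
        apply: (Rmult_eq_reg_l (2 * p2)%R); last lra.
        transitivity ((y + p1) * (2 * y * (y + p1) * p2 + q2) - y * S + N)%R.
        { rewrite /S /N; ring. }
        rewrite e2 eN; ring.
      * pose D := (p1 ^ 2 + 4 * p2 ^ 2)%R.
        have D0 : (p1 ^ 2 <= D)%R by rewrite /D; nra.
        have sD : (sqrt D * sqrt D = D)%R by apply: sqrt_sqrt; nra.
        have sp := sqrt_pos D.
        pose y := ((sqrt D - p1) / 2)%R.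
        have ye : (y * y + p1 * y = p2 * p2)%R.
        { rewrite /y; transitivity ((sqrt D * sqrt D - p1 ^ 2) / 4)%R; first field.
          rewrite sD /D; field. }
        have e2 : (2 * y * (y + p1) * p2 + q2 = 0)%R.
        { transitivity (2 * p2 * (y * y + p1 * y) + q2)%R; first ring.
          rewrite ye -S0 /S; ring. }
        exists y; split; first by rewrite /y; nra.
        split=> //.
        apply: (Rmult_eq_reg_l (2 * p2)%R); last lra.
        transitivity ((y + p1) * (2 * y * (y + p1) * p2 + q2) - y * S + N)%R.
        { rewrite /S /N; ring. }
        rewrite e2 S0 N0; ring.
Qed.

Lemma stokes_eq_real (x : C2) (t : R) :
  stokes_eq x (RtoC t) <->
  (t ^ 2 * ((t ^ 2 + Re (stokesP x)) ^ 2 - Im (stokesP x) ^ 2) + Re (stokesQ x) = 0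
   /\ 2 * t ^ 2 * (t ^ 2 + Re (stokesP x)) * Im (stokesP x) + Im (stokesQ x) = 0)%R.
Proof.
  rewrite stokes_eq_cubic; case: (stokesP x) (stokesQ x) => [p1 p2] [q1 q2] /=.
  set u := (_ + _)%C.
  have e1 : fst u = (t ^ 2 * ((t ^ 2 + p1) ^ 2 - p2 ^ 2) + q1)%R by rewrite /u /=; ring.
  have e2 : snd u = (2 * t ^ 2 * (t ^ 2 + p1) * p2 + q2)%R by rewrite /u /=; ring.
  rewrite -e1 -e2; case: u {e1 e2} => a b /=.
  by split=> [[-> ->]|[-> ->]].
Qed.

(** The sextic is a cubic in [F ^ 2], so its real roots are the square roots of
    the nonnegative roots of that cubic. *)
Lemma real_root_nonneg (x : C2) :
  (exists F : C, stokes_eq x F /\ Im F = 0%R) <->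
  exists y : R, (0 <= y)%R /\
    (y * ((y + Re (stokesP x)) ^ 2 - Im (stokesP x) ^ 2) + Re (stokesQ x) = 0)%R /\
    (2 * y * (y + Re (stokesP x)) * Im (stokesP x) + Im (stokesQ x) = 0)%R.
Proof.
  split.
  - move=> [[t i] [H /= i0]]; rewrite /Im /= in i0; subst i.
    move: H => /(stokes_eq_real x t) [h1 h2].
    by exists (t ^ 2)%R; split; first exact: pow2_ge_0.
  - move=> [y [y0 [h1 h2]]]; exists (RtoC (sqrt y)); split=> //.
    by apply/stokes_eq_real; rewrite pow2_sqrt.
Qed.

(** The gaps are real exactly when [P] and [q] are real and the cubic
    [F ^ 3 + P F + q] has a nonnegative discriminant [- 4 P ^ 3 - 27 q ^ 2]; as
    [q ^ 2 = - Q], reality of [q] means that [Q] is real and nonpositive.  The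
    discriminant is the square of the product of root differences when the roots
    are real, and negative when there is a pair [a + i b], [a - i b] with [b] not
    0. *)
Lemma gaps_realP (x : C2) (r : label -> C) :
  root_triple x r ->
  (forall i j, Im (phase x (r i) - phase x (r j)) = 0%R) <->
  (Im (stokesP x) = 0 /\ Im (stokesQ x) = 0 /\ 0 <= - Re (stokesQ x) /\
   0 <= 27 * Re (stokesQ x) + - (4 * (Re (stokesP x) * Re (stokesP x) * Re (stokesP x))))%R.
Proof.
  move=> rx; split.
  - move=> H.
    have real i j : exists a, gap x r i j = RtoC a.
    { exists (Re (gap x r i j)); apply: injective_projections => //=.
      exact/Im_gap/H. }
    have [eP eQ] := gap_coefficients x r rx.
    have [a ea] := real l1 l2; have [b eb] := real l2 l3.
    have {}eP : stokesP x = RtoC (- (a * a + a * b + b * b))%R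
      by rewrite eP gap_sum ea eb RtoC_opp !RtoC_plus !RtoC_mult; ring.
    have {}eQ : stokesQ x = RtoC (- (a * b * (a + b)) ^ 2)%R
      by rewrite eQ gap_sum ea eb RtoC_opp RtoC_pow !RtoC_mult RtoC_plus; ring.
    rewrite eP eQ /=; split=> //; split=> //; split.
    + have := pow2_ge_0 (a * b * (a + b))%R; rewrite /Re /=; lra.
    + have := pow2_ge_0 ((a - b) * (a + b + b) * (a + a + b))%R; rewrite /Re /=; lra.
  - move=> [P0 [Q0 [Qle disc]]] i j.
    apply/Im_gap.
    have [->|ij] : i = j \/ i <> j by case: i j => [] []; by [left | right].
    { by rewrite /gap /Cminus Cplus_opp_r Cmult_0_r. }
    have : stokes_eq x (gap x r i j) by apply/(stokes_eqP _ _ _ rx); exists i, j.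
    rewrite stokes_eq_cubic; case: (gap x r i j) => a b.
    case: (stokesP x) P0 disc => p p2; case: (stokesQ x) Q0 Qle => q q2.
    rewrite /Re /Im /= => -> Qle -> disc H {q2 p2}.
    (* [u + i w] is [F * (F ^ 2 + P)] at [F = a + i b]; its square is [- Q >= 0],
       so that it is real. *)
    pose u := (a * (a * a - 3 * b * b + p))%R.
    pose w := (b * (3 * a * a - b * b + p))%R.
    have e1 : (u * u - w * w + q = 0)%R
      by have := f_equal fst H; rewrite /u /w /= => <-; ring.
    have e2 : (2 * u * w = 0)%R
      by have := f_equal snd H; rewrite /u /w /= => <-; ring.
    have w0 : w = 0%R.
    { have [u0|//] : u = 0%R \/ w = 0%R by apply: Rmult_integral; lra.
      rewrite u0 in e1; nra. }
    have [//|pe] := Rmult_integral _ _ w0.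
    (* The cubic now has the roots [a + i b], [a - i b] and [- 2 a]. *)
    have ep : (p = b * b - 3 * a * a)%R by lra.
    have eq : (q = - (4 * a * a * (a * a + b * b) * (a * a + b * b)))%R
      by rewrite w0 /u ep in e1; lra.
    (* The discriminant is [- (2 b (9 a ^ 2 + b ^ 2)) ^ 2]. *)
    have key : (4 * (b * (9 * a * a + b * b)) ^ 2 <= 0)%R
      by rewrite ep eq in disc; lra.
    have [//|] : b = 0%R \/ (9 * a * a + b * b = 0)%R.
    { apply: Rmult_integral; have := pow2_ge_0 (b * (9 * a * a + b * b)); nra. }
    nra.
Qed.

Lemma polynomial_stokes :
  polynomial_funC (fun v => stokesP (C2_of_R4 v)) /\
  polynomial_funC (fun v => stokesQ (C2_of_R4 v)).
Proof.
  have x1 : polynomial_funC (fun v => (C2_of_R4 v).1) by split; exact: polynomial_coord.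
  have x2 : polynomial_funC (fun v => (C2_of_R4 v).2) by split; exact: polynomial_coord.
  rewrite /stokesP /stokesQ /Cminus /Cdiv /Cpow.
  by split; repeat first
   [ exact: x1 | exact: x2 | exact: polynomialC_const | apply: polynomialC_plus
   | apply: polynomialC_opp | apply: polynomialC_mult ].
Qed.

Theorem theorem4p3 (zeta : C2 -> label -> C)
    (zetaP : forall x : C2, root_triple x (zeta x)) :
  (forall x : C2,
     stokes_set zeta x <-> exists F : C, stokes_eq x F /\ Im F = 0%R) /\
  semialgebraic_C2 (stokes_set zeta) /\
  (forall l k l' k' : label,
     l <> k -> l' <> k' -> ~ same_type l k l' k' ->
     semialgebraic_C2 (self_intersection zeta l k l' k')).
Proof.
  have [[p1 p2] [q1 q2]] := polynomial_stokes.
  split; last split.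
  - move=> x; exact: stokes_set_eq.
  - apply: semialgebraic_ext => [v|].
    + symmetry; rewrite (stokes_set_eq _ _ zetaP) real_root_nonneg.
      exact: ex_nonneg_root.
    + repeat first [ apply: semialgebraic_ge0 | apply: semialgebraic_or
        | apply: semialgebraic_and | apply: semialgebraic_eq0
        | apply: semialgebraic_neq0 ]; rewrite /Rminus; polynomial.
  - move=> l k l' k' lk lk' ns.
    apply: semialgebraic_ext => [v|].
    + symmetry; rewrite (self_intersectionP _ _ _ _ _ _ zetaP lk lk' ns).
      exact: gaps_realP.
    + repeat first [ apply: semialgebraic_and | apply: semialgebraic_eq0
        | apply: semialgebraic_ge0 ]; polynomial.
Qed.
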